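(* For any $\varepsilon>0$ and sufficiently large $n$, let $C_{n,\varepsilon}=\{A_{r,n}: r=(1/\varepsilon^4)^k,\ k\text{ a nonnegative integer},\ k<\log_{1/\varepsilon^4}n\}$. For any $\delta,\gamma\ge0$ with $\gamma+2\delta<1-\varepsilon$, the code $C_{n,\varepsilon}$ is list-decodable from any $\delta n$ deletions and $\gamma n$ insertions with list size $O(1/\varepsilon^3)$; i.e., for every binary string $v$, the number of codewords $x\in C_{n,\varepsilon}$ from which $v$ can be obtained by at most $\delta n$ deletions and at most $\gamma n$ insertions is $O(\varepsilon^{-3})$.
   Context: For a positive integer $r$, $A_r=(0^r1^r)^\infty$ is the infinite binary string alternating runs of $r$ zeros and $r$ ones, and $A_{r,l}$ denotes its prefix of length $l$ (so $A_{r,n}=(0^r1^r)^{n/(2r)}$ when $2r\mid n$). A string $y$ is obtained from $x$ by $D$ deletions and $I$ insertions if it results from deleting $D$ symbols of $x$ and inserting $I$ symbols. *)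

(* Defs.v *)
From Stdlib Require Import Reals Lra Lia Arith List.
Open Scope R_scope.

Inductive Subseq : list bool -> list bool -> Prop :=
| Subseq_nil : Subseq nil nil
| Subseq_skip : forall z x b, Subseq z x -> Subseq z (b :: x)
| Subseq_take : forall z x b, Subseq z x -> Subseq (b :: z) (b :: x).

Definition del_ins (x y : list bool) (D I : nat) : Prop :=
  exists z, Subseq z x /\ Subseq z y /\
            length x = (length z + D)%nat /\ length y = (length z + I)%nat.

(* A_{r,l}: prefix of length l of (0^r 1^r)^infinity; position i (0-based)
   holds bit floor(i/r) mod 2. *)
Definition A_prefix (r l : nat) : list bool :=
  map (fun i => Nat.odd (i / r)) (seq 0 l).

(* x belongs to C_{n,eps} = { A_{r,n} : r = (1/eps^4)^k, k nonnegative integer,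
   k < log_{1/eps^4} n }; r must be a positive integer for A_r to be defined. *)
Definition in_code (eps : R) (n : nat) (x : list bool) : Prop :=
  exists k r : nat, (0 < r)%nat /\ INR r = (/ eps ^ 4) ^ k /\
    INR k < ln (INR n) / ln (/ eps ^ 4) /\ x = A_prefix r n.

(* Main.v *)
Require Import Defs.
From Stdlib Require Import Reals List.
From Stdlib Require Import Lra Lia Arith Sorted ClassicalEpsilon.
From mathcomp Require ssrnat div.
From Coquelicot Require Rcomplements.
Open Scope R_scope.

(** If [v] arises from [A_{r,n}] by few edits, the common subsequence has length
    [L] with [3 L - |v| - n > eps n].  Split [v] according to the runs of [A_r];
    a pair of consecutive runs contributes [3 (z1 + z2) - l1 - l2 - 2 r], which is
    at most [0] when [v] has constant symbol density on the corresponding window.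
    Take scales [b << r << B] and let [E_s] be averaging of [v] (as a [±1] signal)
    over blocks of length [s].  Replacing [v] by [E_b v] costs [O(b)] per run, and
    [E_B v] is constant on all but [|v| / B] windows, so a close codeword forces
    [E_b v - E_B v] to be large in [l^1], hence to have energy at least
    [eps^2 n / 18].  Two distinct integral powers of [eps^-4] divide one another,
    so they differ by a factor at least [max(2, eps^-4)] and their block partitions
    are nested.  With [b] and [B] the radii six places before and after [r],
    Pythagoras turns the energy into [|E_b v|^2 - |E_B v|^2]; summing over [r]
    telescopes to at most [36 n], which gives [O(1/eps^2)] radii. *)

(** * Prefix sums and block averages *)

Fixpoint psum (f : nat -> R) (n : nat) : R :=
  match n with
  | O => 0
  | S n => psum f n + f n
  end.

Lemma psum_shift (f : nat -> R) (a l : nat) :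
  psum f (a + l) = psum f a + psum (fun i => f (a + i)%nat) l.
Proof.
  induction l as [|l IH].
  - rewrite Nat.add_0_r; simpl; lra.
  - rewrite Nat.add_succ_r; simpl; rewrite IH; lra.
Qed.

Lemma psum_ext (f g : nat -> R) (n : nat) :
  (forall i, (i < n)%nat -> f i = g i) -> psum f n = psum g n.
Proof.
  induction n as [|n IH]; simpl; intros H; [reflexivity|].
  rewrite IH by (intros i Hi; apply H; lia). now rewrite H by lia.
Qed.

Lemma psum_le (f g : nat -> R) (n : nat) :
  (forall i, (i < n)%nat -> f i <= g i) -> psum f n <= psum g n.
Proof.
  induction n as [|n IH]; simpl; intros H; [lra|].
  assert (psum f n <= psum g n) by (apply IH; intros i Hi; apply H; lia).
  assert (f n <= g n) by (apply H; lia). lra.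
Qed.

Lemma psum_const (c : R) (n : nat) : psum (fun _ => c) n = c * INR n.
Proof. induction n as [|n IH]; [simpl; lra|]. rewrite S_INR; simpl; lra. Qed.

Lemma psum_plus (f g : nat -> R) (n : nat) :
  psum (fun i => f i + g i) n = psum f n + psum g n.
Proof. induction n as [|n IH]; simpl; lra. Qed.

Lemma psum_scal (c : R) (f : nat -> R) (n : nat) :
  psum (fun i => c * f i) n = c * psum f n.
Proof. induction n as [|n IH]; simpl; lra. Qed.

Lemma psum_nonneg (f : nat -> R) (n : nat) :
  (forall i, 0 <= f i) -> 0 <= psum f n.
Proof.
  intros H. replace 0 with (psum (fun _ => 0) n) by (rewrite psum_const; lra).
  now apply psum_le.
Qed.

Lemma psum_mono (f : nat -> R) (a b : nat) :
  (forall i, 0 <= f i) -> (a <= b)%nat -> psum f a <= psum f b.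
Proof.
  intros H Hab. replace b with (a + (b - a))%nat by lia. rewrite psum_shift.
  pose proof (psum_nonneg (fun i => f (a + i)%nat) (b - a) (fun i => H _)). lra.
Qed.

Lemma psum_increment_bound (f : nat -> R) (c : R) (a l : nat) :
  (forall t, Rabs (f t) <= c) -> Rabs (psum f (a + l) - psum f a) <= c * INR l.
Proof.
  intros H. rewrite psum_shift.
  assert (psum (fun i => f (a + i)%nat) l <= c * INR l).
  { rewrite <- psum_const. apply psum_le. intros i _.
    specialize (H (a + i)%nat). apply Rcomplements.Rabs_le_between in H. lra. }
  assert (- c * INR l <= psum (fun i => f (a + i)%nat) l).
  { rewrite <- psum_const. apply psum_le. intros i _.
    specialize (H (a + i)%nat). apply Rcomplements.Rabs_le_between in H. lra. }
  apply Rabs_le; lra.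
Qed.

(** The sum telescopes with lag [d] to the [d] values of [F] from index 0 minus the [d] values from
    index [K]; only the former matter for an upper bound. *)
Lemma psum_lag_difference_le (F : nat -> R) (M : R) (d K : nat) :
  (forall i, 0 <= F i <= M) ->
  psum (fun i => F i - F (i + d)%nat) K <= INR d * M.
Proof.
  intros H.
  assert (E : psum (fun i => F i - F (i + d)%nat) K
              = psum F K - (psum F (d + K) - psum F d)).
  { rewrite psum_shift.
    replace (psum F d + psum (fun i => F (d + i)%nat) K - psum F d)
      with (psum (fun i => F (d + i)%nat) K) by ring.
    rewrite (psum_ext _ (fun i => F i + (-1) * F (d + i)%nat)).
    - rewrite psum_plus, psum_scal. ring.
    - intros i _. rewrite (Nat.add_comm d i). ring. }
  assert (psum F K <= psum F (d + K))
    by (apply psum_mono; [intros i; apply H | lia]).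
  assert (psum F d <= M * INR d)
    by (rewrite <- psum_const; apply psum_le; intros i _; apply H).
  lra.
Qed.

(** Conditional expectation of [f] on the partition of the positions into blocks of length [b], read
    at the block of [t]. *)
Definition blockavg (b : nat) (f : nat -> R) (t : nat) : R :=
  (psum f (b * S (t / b)) - psum f (b * (t / b))) / INR b.

Lemma div_in_block (b k i : nat) : (i < b)%nat -> ((b * k + i) / b = k)%nat.
Proof. intros Hi. symmetry. apply (Nat.div_unique _ _ _ i); lia. Qed.

Lemma blockavg_in_block (b : nat) (f : nat -> R) (k i : nat) :
  (i < b)%nat ->
  blockavg b f (b * k + i) = (psum f (b * S k) - psum f (b * k)) / INR b.
Proof. intros Hi. unfold blockavg. now rewrite div_in_block. Qed.

Lemma psum_block_step (b : nat) (f : nat -> R) (k : nat) :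
  psum f (b * S k) = psum f (b * k) + psum (fun i => f (b * k + i)%nat) b.
Proof.
  replace (b * S k)%nat with (b * k + b)%nat by lia. apply psum_shift.
Qed.

Lemma psum_blockavg (b : nat) (f : nat -> R) (k : nat) :
  (0 < b)%nat -> psum (blockavg b f) (b * k) = psum f (b * k).
Proof.
  intros Hb. assert (0 < INR b) by (apply lt_0_INR; lia).
  induction k as [|k IH].
  - now rewrite Nat.mul_0_r.
  - rewrite psum_block_step, IH.
    rewrite (psum_ext _ _ b (fun i Hi => blockavg_in_block b f k i Hi)).
    rewrite psum_const. field. lra.
Qed.

Lemma blockavg_bound (b : nat) (f : nat -> R) (t : nat) :
  (0 < b)%nat -> (forall s, Rabs (f s) <= 1) -> Rabs (blockavg b f t) <= 1.
Proof.
  intros Hb H. assert (0 < INR b) by (apply lt_0_INR; lia).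
  unfold blockavg. replace (b * S (t / b))%nat with (b * (t / b) + b)%nat by lia.
  pose proof (psum_increment_bound f 1 (b * (t / b)) b H).
  unfold Rdiv. rewrite Rabs_mult, (Rabs_right (/ INR b))
    by (apply Rle_ge, Rlt_le, Rinv_0_lt_compat; lra).
  apply Rmult_le_reg_r with (INR b); [lra|].
  rewrite Rmult_assoc, Rinv_l by lra. lra.
Qed.

(** The two prefix sums agree at the last block boundary up to [t]; fewer than [b] positions remain,
    each changing either sum by at most 1. *)
Lemma psum_blockavg_close (b : nat) (f : nat -> R) (t : nat) :
  (0 < b)%nat -> (forall s, Rabs (f s) <= 1) ->
  Rabs (psum (blockavg b f) t - psum f t) <= 2 * INR b.
Proof.
  intros Hb H.
  pose proof (Nat.div_mod t b ltac:(lia)) as E.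
  pose proof (Nat.mod_upper_bound t b ltac:(lia)) as Hm.
  pose proof (psum_increment_bound f 1 (b * (t / b)) (t mod b) H) as H1.
  pose proof (psum_increment_bound (blockavg b f) 1 (b * (t / b)) (t mod b)
    (fun s => blockavg_bound b f s Hb H)) as H2.
  rewrite <- E in H1, H2. rewrite psum_blockavg in H2 by assumption.
  assert (INR (t mod b) <= INR b) by (apply le_INR; lia).
  apply Rcomplements.Rabs_le_between in H1. apply Rcomplements.Rabs_le_between in H2.
  apply Rabs_le. lra.
Qed.

(** Tower property: a block of length [B] is a union of blocks of length [b], and averaging over the
    latter preserves prefix sums at its endpoints. *)
Lemma blockavg_blockavg (b B : nat) (f : nat -> R) (t : nat) :
  (0 < b)%nat -> Nat.divide b B ->
  blockavg B (blockavg b f) t = blockavg B f t.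
Proof.
  intros Hb [c ->]. unfold blockavg at 1 3.
  replace (c * b * S (t / (c * b)))%nat with (b * (c * S (t / (c * b))))%nat by lia.
  replace (c * b * (t / (c * b)))%nat with (b * (c * (t / (c * b))))%nat by lia.
  now rewrite !psum_blockavg by assumption.
Qed.

(** On each block this is the variance identity around the block mean [rho]. *)
Lemma psum_variance (B : nat) (g : nat -> R) (k : nat) :
  (0 < B)%nat ->
  psum (fun t => (g t - blockavg B g t) ^ 2) (B * k)
  = psum (fun t => g t ^ 2) (B * k) - psum (fun t => blockavg B g t ^ 2) (B * k).
Proof.
  intros HB. assert (0 < INR B) by (apply lt_0_INR; lia).
  induction k as [|k IH].
  - rewrite Nat.mul_0_r. simpl. lra.
  - rewrite !(psum_block_step B _ k), IH.
    set (rho := (psum g (B * S k) - psum g (B * k)) / INR B).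
    assert (E : psum (fun i => g (B * k + i)%nat) B = rho * INR B).
    { unfold rho. rewrite (psum_block_step B g k). field. lra. }
    rewrite (psum_ext (fun i => (g (B * k + i)%nat - blockavg B g (B * k + i)) ^ 2)
      (fun i => g (B * k + i)%nat ^ 2 + ((-2 * rho) * g (B * k + i)%nat + rho ^ 2)))
      by (intros i Hi; rewrite blockavg_in_block by assumption; fold rho; ring).
    rewrite (psum_ext (fun i => blockavg B g (B * k + i) ^ 2) (fun _ => rho ^ 2))
      by (intros i Hi; rewrite blockavg_in_block by assumption; fold rho; ring).
    rewrite !psum_plus, psum_scal, !psum_const, E. ring.
Qed.

(** By the tower property [blockavg B f] is the block mean of [blockavg b f], so the variance
    identity applies. This is what lets energies telescope. *)
Lemma psum_blockavg_pythagoras (b B M : nat) (f : nat -> R) :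
  (0 < b)%nat -> (0 < B)%nat -> Nat.divide b B -> Nat.divide B M ->
  psum (fun t => (blockavg b f t - blockavg B f t) ^ 2) M
  = psum (fun t => blockavg b f t ^ 2) M - psum (fun t => blockavg B f t ^ 2) M.
Proof.
  intros Hb HB Hd [c ->]. rewrite (Nat.mul_comm c B).
  rewrite (psum_ext _ (fun t => (blockavg b f t - blockavg B (blockavg b f) t) ^ 2))
    by (intros i _; now rewrite blockavg_blockavg).
  rewrite (psum_ext (fun t => blockavg B f t ^ 2)
             (fun t => blockavg B (blockavg b f) t ^ 2))
    by (intros i _; now rewrite blockavg_blockavg).
  now apply psum_variance.
Qed.

(** * Matching runs *)

(** The first [P] periods of [A_r], in a form that lets an induction peel off one pair of runs. *)
Fixpoint run_pairs (r P : nat) : list bool :=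
  match P with
  | O => nil
  | S P => repeat false r ++ repeat true r ++ run_pairs r P
  end.

Lemma map_constant_repeat {A B : Type} (f : A -> B) (c : B) (l : list A) :
  (forall x, In x l -> f x = c) -> map f l = repeat c (length l).
Proof.
  induction l as [|a l IH]; simpl; intros H; [reflexivity|].
  rewrite H by (now left). rewrite IH by (intros x Hx; apply H; now right).
  reflexivity.
Qed.

(** The window starts at an arbitrary period [k] so that the induction can advance; on run [q] the
    bit is the parity of [q]. *)
Lemma run_pairs_eq (r P k : nat) :
  (0 < r)%nat ->
  map (fun i => Nat.odd (i / r)) (seq (2 * r * k) (2 * r * P)) = run_pairs r P.
Proof.
  intros Hr.
  assert (Hrun : forall q, map (fun i => Nat.odd (i / r)) (seq (r * q) r)
                           = repeat (Nat.odd q) r).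
  { intros q. rewrite (map_constant_repeat _ (Nat.odd q)).
    - now rewrite length_seq.
    - intros x Hx. apply in_seq in Hx. f_equal. symmetry.
      apply (Nat.div_unique _ _ _ (x - r * q)); lia. }
  revert k. induction P as [|P IH]; intros k.
  - now rewrite Nat.mul_0_r.
  - replace (2 * r * S P)%nat with (r + (r + 2 * r * P))%nat by lia.
    rewrite !seq_app, !map_app. cbn [run_pairs].
    replace (2 * r * k)%nat with (r * (2 * k))%nat by lia.
    replace (r * (2 * k) + r)%nat with (r * S (2 * k))%nat by lia.
    replace (r * S (2 * k) + r)%nat with (2 * r * S k)%nat by lia.
    rewrite !Hrun, IH, Nat.odd_succ, Nat.odd_even, Nat.even_even. reflexivity.
Qed.

Lemma Subseq_nil_l (x : list bool) : Subseq nil x.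
Proof. induction x; now constructor. Qed.

Lemma Subseq_app_weaken (z x y : list bool) : Subseq z x -> Subseq z (x ++ y).
Proof.
  induction 1; simpl; [apply Subseq_nil_l | now constructor | now constructor].
Qed.

Lemma Subseq_A_prefix_run_pairs (z : list bool) (r n P : nat) :
  (0 < r)%nat -> (n <= 2 * r * P)%nat ->
  Subseq z (A_prefix r n) -> Subseq z (run_pairs r P).
Proof.
  intros Hr Hn Hz. rewrite <- (run_pairs_eq r P 0 Hr), Nat.mul_0_r.
  replace (2 * r * P)%nat with (n + (2 * r * P - n))%nat by lia.
  rewrite seq_app, map_app. now apply Subseq_app_weaken.
Qed.

Lemma Subseq_app_split_r (z x y : list bool) :
  Subseq z (x ++ y) ->
  exists z1 z2, z = z1 ++ z2 /\ Subseq z1 x /\ Subseq z2 y.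
Proof.
  revert z. induction x as [|b x IH]; simpl; intros z H.
  - exists nil, z. repeat split; [constructor | assumption].
  - inversion H; subst.
    + destruct (IH _ H2) as (z1 & z2 & -> & H1 & H3).
      exists z1, z2. repeat split; [now constructor | assumption].
    + destruct (IH _ H2) as (z1 & z2 & -> & H1 & H3).
      exists (b :: z1), z2. repeat split; [now constructor | assumption].
Qed.

Lemma Subseq_app_split_l (z1 z2 x : list bool) :
  Subseq (z1 ++ z2) x ->
  exists x1 x2, x = x1 ++ x2 /\ Subseq z1 x1 /\ Subseq z2 x2.
Proof.
  revert z1. induction x as [|b x IH]; intros z1 H.
  - inversion H as [E| |]. symmetry in E. apply app_eq_nil in E. destruct E; subst.
    exists nil, nil. repeat split; constructor.
  - destruct z1 as [|c z1].
    { exists nil, (b :: x). repeat split; [constructor | assumption]. }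
    inversion H; subst.
    + destruct (IH (c :: z1) H2) as (x1 & x2 & -> & H1 & H3).
      exists (b :: x1), x2. repeat split; [now constructor | assumption].
    + destruct (IH z1 H1) as (x1 & x2 & -> & H4 & H5).
      exists (b :: x1), x2. repeat split; [now constructor | assumption].
Qed.

Lemma Subseq_length (z x : list bool) : Subseq z x -> (length z <= length x)%nat.
Proof. induction 1; simpl; lia. Qed.

Lemma Subseq_count (z x : list bool) (c : bool) :
  Subseq z x -> (count_occ Bool.bool_dec z c <= count_occ Bool.bool_dec x c)%nat.
Proof.
  induction 1 as [|z x b _ IH|z x b _ IH]; simpl; [lia| |];
    destruct (Bool.bool_dec b c); lia.
Qed.

Lemma Subseq_repeat_count (z : list bool) (b : bool) (r : nat) :
  Subseq z (repeat b r) -> count_occ Bool.bool_dec z b = length z.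
Proof.
  revert z. induction r as [|r IH]; simpl; intros z H; inversion H; subst; simpl.
  - reflexivity.
  - now apply IH.
  - destruct (Bool.bool_dec b b); [|congruence]. f_equal. now apply IH.
Qed.

(** A piece matched inside one run repeats the symbol [b], so each of its symbols uses up a copy of
    [b] in [x]. *)
Lemma run_match_length (z x : list bool) (b : bool) (r : nat) :
  Subseq z (repeat b r) -> Subseq z x ->
  (length z <= r)%nat /\ (length z <= length x)%nat /\
  (length z <= count_occ Bool.bool_dec x b)%nat.
Proof.
  intros H1 H2. repeat split.
  - apply Subseq_length in H1. now rewrite repeat_length in H1.
  - now apply Subseq_length.
  - rewrite <- (Subseq_repeat_count z b r H1). now apply Subseq_count.
Qed.

(** * Integral powers and sorted lists *)

(** The radii are integral powers of a real base, so divisibility is first visible between powers of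
    radii; this root extraction, resting on [dvdn_pexp2r], brings it down. *)
Lemma nat_divide_of_pow_divide (a b k : nat) :
  (0 < k)%nat -> Nat.divide (a ^ k) (b ^ k) -> Nat.divide a b.
Proof.
  assert (E : forall m j : nat, (m ^ j)%nat = ssrnat.expn m j).
  { intros m j. induction j as [|j IH]; [reflexivity|].
    rewrite ssrnat.expnS, <- IH. reflexivity. }
  intros Hk [c Hc].
  assert (D : is_true (div.dvdn (ssrnat.expn a k) (ssrnat.expn b k))).
  { rewrite <- !E, Hc. apply div.dvdn_mull, div.dvdnn. }
  rewrite div.dvdn_pexp2r in D by (now apply (Corelib.ssr.ssrbool.introT ssrnat.ltP)).
  destruct (Corelib.ssr.ssrbool.elimT div.dvdnP D) as [d ->]. now exists d.
Qed.

(** Both [r2 ^ k1] and [r1 ^ k2] equal [p ^ (k1 * k2)], so [r1 ^ k1] divides [r2 ^ k1] because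
    [k1 < k2]. A proper divisor yields the factor 2, which is uniform even for [p] near 1. *)
Lemma integer_powers_separated (p : R) (k1 k2 r1 r2 : nat) :
  1 < p -> INR r1 = p ^ k1 -> INR r2 = p ^ k2 -> (r1 < r2)%nat ->
  Nat.divide r1 r2 /\ (2 * r1 <= r2)%nat /\ p * INR r1 <= INR r2.
Proof.
  intros Hp H1 H2 Hr.
  assert (Hk : (k1 < k2)%nat).
  { destruct (Nat.lt_ge_cases k1 k2) as [|Hge]; [assumption|exfalso].
    apply lt_INR in Hr. pose proof (Rle_pow p k2 k1 ltac:(lra) Hge). lra. }
  assert (Hpos : 0 < p ^ k1) by (apply pow_lt; lra).
  assert (Hr1 : (0 < r1)%nat) by (apply INR_lt; simpl; lra).
  assert (Hd : Nat.divide r1 r2).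
  { destruct (Nat.eq_0_gt_0_cases k1) as [-> | Hk1].
    - assert (r1 = 1%nat) as -> by (apply INR_eq; simpl in *; lra).
      exists r2. lia.
    - apply (nat_divide_of_pow_divide _ _ k1 Hk1).
      assert (E : (r2 ^ k1 = r1 ^ k2)%nat).
      { apply INR_eq. rewrite !pow_INR, H1, H2, <- !pow_mult.
        f_equal. lia. }
      rewrite E. exists (r1 ^ (k2 - k1))%nat. rewrite <- Nat.pow_add_r.
      f_equal. lia. }
  split; [assumption|split].
  - destruct Hd as [c Hc]. destruct c as [|[|c]]; nia.
  - rewrite H1, H2. change (p * p ^ k1) with (p ^ S k1).
    apply Rle_pow; [lra|lia].
Qed.

Lemma StronglySorted_filter {A : Type} (R : A -> A -> Prop) (f : A -> bool) (l : list A) :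
  StronglySorted R l -> StronglySorted R (filter f l).
Proof.
  induction 1 as [|a l Hl IH Ha]; simpl; [constructor|].
  destruct (f a); [|assumption].
  constructor; [assumption|]. exact (incl_Forall (incl_filter f l) Ha).
Qed.

Lemma StronglySorted_seq (a n : nat) : StronglySorted lt (seq a n).
Proof.
  revert a. induction n as [|n IH]; intros a; simpl; constructor; [apply IH|].
  apply Forall_forall. intros x Hx. apply in_seq in Hx. lia.
Qed.

Lemma StronglySorted_nth {A : Type} (R : A -> A -> Prop) (l : list A) (d : A) (i j : nat) :
  StronglySorted R l -> (i < j < length l)%nat -> R (nth i l d) (nth j l d).
Proof.
  intros H. revert i j. induction H as [|a l Hl IH Ha]; simpl; intros i j Hij; [lia|].
  destruct j as [|j]; [lia|]. destruct i as [|i].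
  - rewrite Forall_forall in Ha. apply Ha, nth_In. lia.
  - apply IH. lia.
Qed.

(** * Matching gain and block averages *)

(** The value [0] past the end lets averaging blocks overrun the string. *)
Definition bit_sign (v : list bool) (t : nat) : R :=
  match nth_error v t with
  | Some false => 1
  | Some true => -1
  | None => 0
  end.

Lemma bit_sign_bound (v : list bool) (t : nat) : Rabs (bit_sign v t) <= 1.
Proof.
  unfold bit_sign. destruct (nth_error v t) as [[]|]; apply Rabs_le; lra.
Qed.

Lemma psum_bit_sign_full (w post : list bool) :
  psum (bit_sign (w ++ post)) (length w)
    = 2 * INR (count_occ Bool.bool_dec w false) - INR (length w) /\
  psum (bit_sign (w ++ post)) (length w)
    = INR (length w) - 2 * INR (count_occ Bool.bool_dec w true).
Proof.
  induction w as [|b w [IH1 IH2]]; [simpl; lra|].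
  change (length (b :: w)) with (1 + length w)%nat. rewrite psum_shift.
  change (psum (fun i => bit_sign ((b :: w) ++ post) (1 + i)) (length w))
    with (psum (bit_sign (w ++ post)) (length w)).
  rewrite plus_INR.
  replace (psum (bit_sign ((b :: w) ++ post)) 1) with (if b then -1 else 1)
    by (destruct b; unfold bit_sign; simpl; lra).
  rewrite INR_1. destruct b; cbn -[INR psum bit_sign]; rewrite ?S_INR; split; lra.
Qed.

Lemma psum_bit_sign (pre w post : list bool) :
  let f := bit_sign (pre ++ w ++ post) in
  psum f (length pre + length w) - psum f (length pre)
    = 2 * INR (count_occ Bool.bool_dec w false) - INR (length w) /\
  psum f (length pre + length w) - psum f (length pre)
    = INR (length w) - 2 * INR (count_occ Bool.bool_dec w true).
Proof.
  intros f. rewrite psum_shift.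
  rewrite (psum_ext (fun i => f (length pre + i)%nat) (bit_sign (w ++ post))).
  - pose proof (psum_bit_sign_full w post). lra.
  - intros i Hi. unfold f, bit_sign. rewrite nth_error_app2 by lia.
    now replace (length pre + i - length pre)%nat with i by lia.
Qed.

(* The excess [3 x - l] is at most [(3 - 2/(1+rho)) r], resp. [(3 - 2/(1-rho)) r],
   when these factors are nonnegative, and they add up to
   [6 - 4/(1-rho^2) <= 2]. *)
Lemma constant_density_no_gain_nonneg (rho l1 l2 p q r : R) :
  0 <= rho <= 1 -> 0 <= l1 -> 0 <= l2 -> 0 <= r -> p <= r -> q <= r ->
  2 * p <= (1 + rho) * l1 -> 2 * q <= (1 - rho) * l2 ->
  3 * p + 3 * q <= l1 + l2 + 2 * r.
Proof.
  intros Hrho Hl1 Hl2 Hr Hp Hq Hp1 Hq1.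
  (* At [rho = 1/3] the factor [3 - 2/(1-rho)] changes sign. From there on [3 q <= l2], while
     [p <= l1] and [p <= r] give [3 p <= l1 + 2 r]. *)
  destruct (Rle_lt_dec (1 / 3) rho) as [Hbig|Hsmall].
  - assert (3 * q <= l2) by nra. nra.
  - set (u := / (1 + rho)). set (w := / (1 - rho)).
    assert (Hu : u * (1 + rho) = 1) by (apply Rinv_l; lra).
    assert (Hw : w * (1 - rho) = 1) by (apply Rinv_l; lra).
    assert (0 < u) by (apply Rinv_0_lt_compat; lra).
    assert (0 < w) by (apply Rinv_0_lt_compat; lra).
    assert (2 * p * u <= l1).
    { replace l1 with (u * ((1 + rho) * l1))
        by (rewrite <- Rmult_assoc, Hu; ring). nra. }
    assert (2 * q * w <= l2).
    { replace l2 with (w * ((1 - rho) * l2))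
        by (rewrite <- Rmult_assoc, Hw; ring). nra. }
    assert (u <= 1) by nra.
    assert (w <= 3 / 2) by nra.
    assert (2 <= u + w).
    { assert (u + w = 2 * (u * w)) by nra.
      assert (u * w * (1 - rho ^ 2) = 1) by nra. nra. }
    assert ((3 - 2 * u) * p <= (3 - 2 * u) * r) by (apply Rmult_le_compat_l; lra).
    assert ((3 - 2 * w) * q <= (3 - 2 * w) * r) by (apply Rmult_le_compat_l; lra).
    nra.
Qed.

(** Here [(1 + rho) / 2] and [(1 - rho) / 2] are the densities of zeros and ones; for negative [rho]
    the two runs exchange roles. *)
Lemma constant_density_no_gain (rho l1 l2 p q r : R) :
  -1 <= rho <= 1 -> 0 <= l1 -> 0 <= l2 -> 0 <= r -> p <= r -> q <= r ->
  2 * p <= (1 + rho) * l1 -> 2 * q <= (1 - rho) * l2 ->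
  3 * p + 3 * q <= l1 + l2 + 2 * r.
Proof.
  intros. destruct (Rle_lt_dec 0 rho).
  - apply (constant_density_no_gain_nonneg rho); lra.
  - pose proof (constant_density_no_gain_nonneg (- rho) l2 l1 q p r). lra.
Qed.

Definition avg_gap (b B : nat) (f : nat -> R) (t : nat) : R :=
  Rabs (blockavg b f t - blockavg B f t).

(** Replacing [f] by [blockavg b f] costs [2 b] at each end of the window; within one block of
    length [B] the coarse average is the constant [rho], and the gap sum pays for the rest. *)
Lemma psum_increment_density (f : nat -> R) (b B t l k : nat) :
  (0 < b)%nat -> (0 < B)%nat -> (forall s, Rabs (f s) <= 1) ->
  (t / B = k)%nat -> ((t + l) / B = k)%nat ->
  let rho := blockavg B f (B * k) in
  let d := psum (avg_gap b B f) (t + l) - psum (avg_gap b B f) t in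
  Rabs (psum f (t + l) - psum f t - rho * INR l) <= 4 * INR b + d.
Proof.
  intros Hb HB Hf Ht Htl rho d.
  pose proof (psum_blockavg_close b f t Hb Hf) as H1.
  pose proof (psum_blockavg_close b f (t + l) Hb Hf) as H2.
  assert (Hk : forall i, (i < l)%nat -> blockavg B f (t + i) = rho).
  { intros i Hi. unfold rho, blockavg.
    rewrite (Nat.mul_comm B k), Nat.div_mul by lia.
    replace ((t + i) / B)%nat with k; [reflexivity|].
    apply Nat.le_antisymm.
    - rewrite <- Ht. apply Nat.Div0.div_le_mono. lia.
    - rewrite <- Htl. apply Nat.Div0.div_le_mono. lia. }
  assert (H3 : Rabs (psum (blockavg b f) (t + l) - psum (blockavg b f) t - rho * INR l) <= d).
  { unfold d. rewrite !psum_shift, <- psum_const.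
    set (g := fun i => blockavg b f (t + i)%nat).
    assert (psum g l <= psum (fun i => rho + avg_gap b B f (t + i)%nat) l).
    { apply psum_le. intros i Hi. unfold avg_gap, g. rewrite Hk by assumption.
      pose proof (Rle_abs (blockavg b f (t + i) - rho)). lra. }
    assert (psum (fun _ => rho) l <= psum (fun i => g i + avg_gap b B f (t + i)%nat) l).
    { apply psum_le. intros i Hi. unfold avg_gap, g. rewrite Hk by assumption.
      pose proof (Rle_abs (- (blockavg b f (t + i) - rho))).
      rewrite Rabs_Ropp in H0. lra. }
    rewrite psum_plus in *. apply Rabs_le. lra. }
  apply Rcomplements.Rabs_le_between in H1. apply Rcomplements.Rabs_le_between in H2.
  apply Rcomplements.Rabs_le_between in H3. apply Rabs_le. lra.
Qed.

(** Induction over pairs of runs, with [pre] the part of [v] already consumed. The two density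
    errors [4 b + d] are halved, a count being half a signed sum, and tripled: hence [12 b] and
    [3/2] of the gap. The last term pays for windows that cross a block boundary. *)
Lemma run_pairs_match_bound (v : list bool) (b B r : nat) :
  (0 < b)%nat -> (0 < B)%nat ->
  forall (P : nat) (z w pre : list bool),
  v = pre ++ w -> Subseq z (run_pairs r P) -> Subseq z w ->
  let gap := psum (avg_gap b B (bit_sign v)) in
  3 * INR (length z) <=
    INR (length w) + 2 * INR r * INR P + 12 * INR b * INR P
    + 3 / 2 * (gap (length v) - gap (length pre))
    + 2 * INR r * (INR (length v / B) - INR (length pre / B)).
Proof.
  intros Hb HB P. set (f := bit_sign v).
  assert (Hgap : forall s t, (s <= t)%nat ->
    psum (avg_gap b B f) s <= psum (avg_gap b B f) t).
  { intros s t. apply psum_mono. intros i. apply Rabs_pos. }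
  assert (Hblk : forall s t, (s <= t)%nat -> INR (s / B) <= INR (t / B)).
  { intros s t Hst. apply le_INR, Nat.Div0.div_le_mono, Hst. }
  assert (Hr : 0 <= INR r) by apply pos_INR.
  assert (Hb' : 0 <= INR b) by apply pos_INR.
  induction P as [|P IH]; cbn zeta; intros z w pre Hv Hz Hzw.
  - inversion Hz; subst z.
    assert (length pre <= length v)%nat by (rewrite Hv, length_app; lia).
    pose proof (Hgap (length pre) (length v) H).
    pose proof (Hblk (length pre) (length v) H).
    pose proof (pos_INR (length w)). simpl (INR (length nil)). simpl (INR 0). nra.
  - cbn [run_pairs] in Hz.
    (* Cut the common subsequence along the first two runs, then cut [w] along the resulting
       pieces. *)
    apply Subseq_app_split_r in Hz as (z1 & z' & -> & Hz1 & Hz').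
    apply Subseq_app_split_r in Hz' as (z2 & z3 & -> & Hz2 & Hz3).
    apply Subseq_app_split_l in Hzw as (w1 & w' & -> & Hw1 & Hw').
    apply Subseq_app_split_l in Hw' as (w2 & w3 & -> & Hw2 & Hw3).
    destruct (run_match_length _ _ _ _ Hz1 Hw1) as (A1 & A2 & A3).
    destruct (run_match_length _ _ _ _ Hz2 Hw2) as (B1 & B2 & B3).
    apply le_INR in A1, A2, A3, B1, B2, B3.
    assert (IH' := IH z3 w3 (pre ++ w1 ++ w2)
      ltac:(rewrite Hv, <- !app_assoc; reflexivity) Hz3 Hw3).
    cbn zeta in IH'.
    pose proof (psum_bit_sign pre w1 (w2 ++ w3)) as [C1 _].
    pose proof (psum_bit_sign (pre ++ w1) w2 w3) as [_ C2].
    cbn zeta in C1, C2.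
    replace ((pre ++ w1) ++ w2 ++ w3) with (pre ++ w1 ++ w2 ++ w3) in C2
      by now rewrite <- app_assoc.
    rewrite <- Hv in C1, C2. fold f in C1, C2, IH'.
    rewrite !length_app in *. rewrite !plus_INR.
    rewrite Nat.add_assoc in IH'.
    set (t0 := length pre) in *. set (t1 := (t0 + length w1)%nat) in *.
    set (t2 := (t1 + length w2)%nat) in *.
    pose proof (Hgap t0 t1 ltac:(unfold t1; lia)).
    pose proof (Hgap t1 t2 ltac:(unfold t2; lia)).
    rewrite S_INR.
    assert (Hle : (t0 / B <= t2 / B)%nat)
      by (apply Nat.Div0.div_le_mono; unfold t2, t1; lia).
    destruct (Nat.lt_ge_cases (t0 / B) (t2 / B)) as [Hlt|Hge].
    (* A crossing window: [3 z <= l + 2 r] for each run overshoots the pair's allowance by [2 r],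
       paid by the growth of the block index. *)
    + apply le_INR in Hlt. rewrite S_INR in Hlt. nra.
    + assert (E2 : (t2 / B = t0 / B)%nat) by lia.
      assert (E1 : (t1 / B = t0 / B)%nat).
      { apply Nat.le_antisymm.
        - rewrite <- E2. apply Nat.Div0.div_le_mono. unfold t2; lia.
        - apply Nat.Div0.div_le_mono. unfold t1; lia. }
      pose proof (psum_increment_density f b B t0 (length w1) (t0 / B) Hb HB
        (bit_sign_bound v) eq_refl E1) as D1.
      pose proof (psum_increment_density f b B t1 (length w2) (t0 / B) Hb HB
        (bit_sign_bound v) E1 E2) as D2.
      cbn zeta in D1, D2. fold t1 in D1. fold t2 in D2.
      pose proof (blockavg_bound B f (B * (t0 / B)) HB (bit_sign_bound v)) as Hrho.
      set (rho := blockavg B f (B * (t0 / B))) in *.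
      apply Rcomplements.Rabs_le_between in D1, D2, Hrho.
      set (G := psum (avg_gap b B f)) in *.
      (* Matched lengths reduced by half the density error obey the exact density inequalities. *)
      pose proof (constant_density_no_gain rho (INR (length w1)) (INR (length w2))
        (INR (length z1) - (4 * INR b + (G t1 - G t0)) / 2)
        (INR (length z2) - (4 * INR b + (G t2 - G t1)) / 2) (INR r)
        Hrho (pos_INR _) (pos_INR _) Hr).
      rewrite E2 in IH'. lra.
Qed.

(** * Energy of close codewords *)

Lemma length_A_prefix (r n : nat) : length (A_prefix r n) = n.
Proof. unfold A_prefix. now rewrite length_map, length_seq. Qed.

(** The sum runs to [M] rather than to the length of [v] because Pythagoras requires whole blocks;
    the extra squares are nonnegative. *)
Lemma close_codeword_energy (eps : R) (n b r B D I M : nat) (v : list bool) :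
  0 < eps < 1 -> (0 < b)%nat -> (0 < r)%nat -> (B <= n)%nat ->
  32 * INR b <= eps * INR r -> 32 * INR r <= eps * INR B ->
  del_ins (A_prefix r n) v D I -> INR I + 2 * INR D < (1 - eps) * INR n ->
  (length v <= M)%nat ->
  eps ^ 2 * INR n / 18 <=
    psum (fun t => (blockavg b (bit_sign v) t - blockavg B (bit_sign v) t) ^ 2) M.
Proof.
  intros He Hb Hr HBn Hbr HrB (z & Hz & Hzv & HD & HI) HDI HM.
  rewrite length_A_prefix in HD.
  assert (Rb : 0 < INR b) by (apply lt_0_INR; lia).
  assert (Rr : 0 < INR r) by (apply lt_0_INR; lia).
  assert (HB : (0 < B)%nat) by (apply INR_lt; simpl; nra).
  apply le_INR in HBn.
  assert (RB : 0 < INR B) by (apply lt_0_INR; lia).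
  set (P := S (n / (2 * r))).
  assert (HP1 : (n <= 2 * r * P)%nat).
  { unfold P. pose proof (Nat.mul_succ_div_gt n (2 * r) ltac:(lia)). lia. }
  assert (HP2 : (2 * r * P <= n + 2 * r)%nat).
  { unfold P. pose proof (Nat.Div0.mul_div_le n (2 * r)). lia. }
  assert (Hmatch := run_pairs_match_bound v b B r Hb HB P z v nil eq_refl
    (Subseq_A_prefix_run_pairs z r n P Hr HP1 Hz) Hzv).
  cbn zeta in Hmatch. rewrite Nat.Div0.div_0_l in Hmatch.
  simpl (length nil) in Hmatch. change (INR 0) with 0 in Hmatch.
  simpl (psum _ 0) in Hmatch.
  set (f := bit_sign v) in *. set (m := length v) in *.
  apply (f_equal INR) in HD, HI. rewrite plus_INR in HD, HI.
  pose proof (pos_INR I). pose proof (pos_INR D).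
  assert (Hm : INR m <= 2 * INR n) by nra.
  apply le_INR in HP2. rewrite plus_INR, !mult_INR in HP2. change (INR 2) with 2 in HP2.
  assert (Hg : INR B * INR (m / B) <= INR m)
    by (rewrite <- mult_INR; apply le_INR, Nat.Div0.mul_div_le).
  set (g := INR (m / B)) in *. assert (0 <= g) by apply pos_INR.
  assert (0 <= INR P) by apply pos_INR.
  assert (Hrn : 32 * INR r <= eps * INR n) by nra.
  assert (HbP : 32 * (INR b * INR P) <= eps * (INR n / 2 + INR r)).
  { apply Rle_trans with (eps * (INR r * INR P)); [nra|].
    apply Rmult_le_compat_l; lra. }
  assert (Hrg : 32 * (INR r * g) <= eps * (2 * INR n)).
  { apply Rle_trans with (eps * (INR B * g)); [nra|].
    apply Rmult_le_compat_l; lra. }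
  assert (Her : eps * INR r <= INR r) by nra.
  (* The surplus [3 |z| - |v| - n = n - 2 D - I] exceeds [eps n]. Rounding to whole periods, fine
     averaging and boundary crossings take less than half of it; dividing the remaining [eps n / 2]
     by [3/2] gives the bound. *)
  assert (Hgap : eps * INR n / 3 <= psum (avg_gap b B f) m) by nra.
  set (sq := fun t => (blockavg b f t - blockavg B f t) ^ 2).
  (* AM-GM, weighted so that the constant term sums to at most [eps n / 6], half the lower bound *)
  assert (Hamgm : psum (avg_gap b B f) m <= psum (fun t => eps / 12 + 3 / eps * sq t) m).
  { apply psum_le. intros t _. unfold avg_gap, sq.
    set (x := blockavg b f t - blockavg B f t).
    rewrite <- (pow2_abs x). pose proof (pow2_ge_0 (eps - 6 * Rabs x)).
    apply Rmult_le_reg_l with (12 * eps); [lra|].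
    replace (12 * eps * (eps / 12 + 3 / eps * Rabs x ^ 2))
      with (eps ^ 2 + 36 * Rabs x ^ 2) by (field; lra). nra. }
  rewrite psum_plus, psum_scal, psum_const in Hamgm.
  assert (HmM : psum sq m <= psum sq M)
    by (apply psum_mono; [intros i; apply pow2_ge_0 | assumption]).
  apply Rle_trans with (psum sq m); [|assumption].
  assert (Hk : eps * INR n / 6 <= 3 / eps * psum sq m) by nra.
  apply Rmult_le_reg_l with (3 / eps); [apply Rdiv_lt_0_compat; lra|].
  replace (3 / eps * (eps ^ 2 * INR n / 18)) with (eps * INR n / 6) by (field; lra).
  assumption.
Qed.

(** * From the energy bound to the number of close radii *)

Lemma code_radius_lt (p : R) (k r n : nat) :
  1 < p -> (0 < n)%nat -> INR r = p ^ k -> INR k < ln (INR n) / ln p -> (r < n)%nat.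
Proof.
  intros Hp Hn Hr Hk. apply INR_lt. rewrite Hr.
  assert (0 < INR n) by (apply lt_0_INR; lia).
  assert (Hln : 0 < ln p) by (rewrite <- ln_1; apply ln_increasing; lra).
  apply ln_lt_inv; [apply pow_lt; lra | assumption |].
  rewrite ln_pow by lra.
  apply Rmult_lt_compat_r with (r := ln p) in Hk; [|assumption].
  unfold Rdiv in Hk. rewrite Rmult_assoc, Rinv_l, Rmult_1_r in Hk by lra. exact Hk.
Qed.

(** The first step supplies the factor [p], the other five supply [2 ^ 5 = 32]. *)
Lemma six_steps_separated (p : R) (rho : nat -> nat) (i : nat) :
  (forall j, (i <= j < i + 6)%nat ->
     (2 * rho j <= rho (S j))%nat /\ p * INR (rho j) <= INR (rho (S j))) ->
  0 < p -> 32 * (p * INR (rho i)) <= INR (rho (i + 6)%nat).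
Proof.
  intros H Hp.
  assert (H0 : p * INR (rho i) <= INR (rho (S i))) by (apply H; lia).
  assert (H5 : (32 * rho (S i) <= rho (i + 6))%nat).
  { destruct (H (i + 1)%nat ltac:(lia)) as [H1 _].
    destruct (H (i + 2)%nat ltac:(lia)) as [H2 _].
    destruct (H (i + 3)%nat ltac:(lia)) as [H3 _].
    destruct (H (i + 4)%nat ltac:(lia)) as [H4 _].
    destruct (H (i + 5)%nat ltac:(lia)) as [H5 _].
    rewrite <- !Nat.add_succ_r in *. rewrite Nat.add_1_r in H1. lia. }
  apply le_INR in H5. rewrite mult_INR in H5.
  replace (INR 32) with 32 in H5 by (simpl; lra). lra.
Qed.

Lemma divisor_chain (rho : nat -> nat) (i j : nat) :
  (i <= j)%nat -> (forall l, (i <= l < j)%nat -> Nat.divide (rho l) (rho (S l))) ->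
  Nat.divide (rho i) (rho j).
Proof.
  induction 1 as [|j Hij IH]; intros H; [apply Nat.divide_refl|].
  apply Nat.divide_trans with (rho j).
  - apply IH. intros l Hl. apply H. lia.
  - apply H. lia.
Qed.

(** Each of the [K - 12] radii with six others on either side forces an energy drop across lag 12,
    and lagged telescoping bounds the total drop. *)
Lemma close_radii_count (eps : R) (n : nat) (v : list bool) (rs : list nat) :
  0 < eps < 1 -> (0 < n)%nat -> StronglySorted lt rs ->
  (forall r, In r rs ->
     (0 < r < n)%nat /\ (exists k, INR r = (/ eps ^ 4) ^ k) /\
     exists D I, INR I + 2 * INR D < (1 - eps) * INR n /\
                 del_ins (A_prefix r n) v D I) ->
  INR (length rs) <= 660 / eps ^ 3.
Proof.
  intros He Hn Hsort Hin.
  assert (Rn : 0 < INR n) by (apply lt_0_INR; lia).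
  assert (He3 : 0 < eps ^ 3 <= 1).
  { split; [apply pow_lt; lra|]. rewrite <- (pow1 3). apply pow_incr. lra. }
  assert (Hp : 1 < / eps ^ 4).
  { rewrite <- Rinv_1. apply Rinv_0_lt_contravar; [apply pow_lt; lra|].
    replace (eps ^ 4) with (eps ^ 3 * eps) by ring. nra. }
  set (p := / eps ^ 4) in *. set (K := length rs).
  set (rho := fun i => nth i rs 0%nat).
  assert (Hrho : forall i, (i < K)%nat -> In (rho i) rs)
    by (intros i Hi; now apply nth_In).
  assert (Hstep : forall i, (S i < K)%nat -> Nat.divide (rho i) (rho (S i)) /\
    (2 * rho i <= rho (S i))%nat /\ p * INR (rho i) <= INR (rho (S i))).
  { intros i Hi.
    destruct (Hin _ (Hrho i ltac:(lia))) as (_ & [k1 E1] & _).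
    destruct (Hin _ (Hrho (S i) Hi)) as (_ & [k2 E2] & _).
    apply (integer_powers_separated p k1 k2); try assumption.
    apply StronglySorted_nth; [assumption | fold K; lia]. }
  destruct (Nat.le_gt_cases K 12) as [Hsmall|Hbig].
  { apply le_INR in Hsmall. replace (INR 12) with 12 in Hsmall by (simpl; lra).
    apply Rmult_le_reg_r with (eps ^ 3); [lra|].
    unfold Rdiv. rewrite Rmult_assoc, Rinv_l by lra. nra. }
  destruct (Hin _ (Hrho 0%nat ltac:(lia))) as (_ & _ & D0 & I0 & HDI0 & z0 & Hz0 & _ & HD0 & HI0).
  rewrite length_A_prefix in HD0.
  assert (Hv : (length v <= 2 * n)%nat).
  { apply INR_le. rewrite HI0, plus_INR, mult_INR. apply (f_equal INR) in HD0.
    rewrite plus_INR in HD0. change (INR 2) with 2.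
    pose proof (pos_INR D0). nra. }
  destruct (Hin _ (Hrho (K - 1)%nat ltac:(lia))) as (Hlast & _).
  (* Every radius divides the largest one, [R]; rounding the length of [v] up to a multiple of [R]
     makes [M] consist of whole blocks at every scale. *)
  set (R := rho (K - 1)%nat) in *.
  set (M := (R * S (length v / R))%nat).
  assert (HM1 : (length v <= M)%nat).
  { pose proof (Nat.mul_succ_div_gt (length v) R ltac:(lia)). unfold M. lia. }
  assert (HM2 : (M <= 3 * n)%nat).
  { pose proof (Nat.Div0.mul_div_le (length v) R). unfold M. lia. }
  set (f := bit_sign v).
  (* The telescoping bound needs [F] controlled at all indices, so energies beyond the list are set
     to [0]. *)
  set (F := fun i => if Nat.ltb i K then psum (fun t => blockavg (rho i) f t ^ 2) M else 0).
  assert (HF : forall i, 0 <= F i <= INR M).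
  { intros i. unfold F. destruct (Nat.ltb_spec i K) as [Hi|Hi];
      [|pose proof (pos_INR M); lra].
    destruct (Hin _ (Hrho i Hi)) as (Hpos & _). split.
    - apply psum_nonneg. intros t. apply pow2_ge_0.
    - rewrite <- (Rmult_1_l (INR M)), <- psum_const. apply psum_le. intros t _.
      rewrite <- pow2_abs. rewrite <- (pow1 2). apply pow_incr.
      split; [apply Rabs_pos|]. apply blockavg_bound; [lia | apply bit_sign_bound]. }
  assert (Hdrop : forall i, (i < K - 12)%nat -> eps ^ 2 * INR n / 18 <= F i - F (i + 12)%nat).
  { intros i Hi.
    destruct (Hin _ (Hrho i ltac:(lia))) as (Hb & _).
    destruct (Hin _ (Hrho (i + 6)%nat ltac:(lia))) as (Hr & _ & D & I & HDI & Hdel).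
    destruct (Hin _ (Hrho (i + 12)%nat ltac:(lia))) as (HB & _).
    assert (Hsep : forall j, (j + 6 < K)%nat ->
      32 * INR (rho j) <= eps * INR (rho (j + 6)%nat)).
    { intros j Hj.
      pose proof (six_steps_separated p rho j
        ltac:(intros l Hl; apply Hstep; lia) ltac:(lra)) as H6.
      (* Since [eps * p = eps ^ -3], the factor [p] from six steps absorbs the [eps] in the required
         separation. *)
      assert (Hpe : 1 <= eps * p).
      { unfold p. replace (eps * / eps ^ 4) with (/ eps ^ 3) by (field; lra).
        rewrite <- Rinv_1. apply Rinv_le_contravar; lra. }
      pose proof (pos_INR (rho j)).
      apply Rle_trans with (eps * (32 * (p * INR (rho j)))); [nra|].
      apply Rmult_le_compat_l; lra. }
    unfold F. rewrite !(proj2 (Nat.ltb_lt _ _)) by lia.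
    rewrite <- psum_blockavg_pythagoras; [|lia|lia| |].
    - apply (close_codeword_energy eps n (rho i) (rho (i + 6)%nat) _ D I);
        try assumption; try lia.
      + apply Hsep; lia.
      + replace (i + 12)%nat with (i + 6 + 6)%nat by lia. apply Hsep; lia.
    - apply divisor_chain; [lia|]. intros l Hl. apply Hstep. lia.
    - apply Nat.divide_trans with R; [|unfold M; exists (S (length v / R)); lia].
      apply divisor_chain; [lia|]. intros l Hl. apply Hstep. lia. }
  pose proof (psum_lag_difference_le F (INR M) 12 (K - 12) HF) as Hup.
  assert (Hlow : eps ^ 2 * INR n / 18 * INR (K - 12) <=
                 psum (fun i => F i - F (i + 12)%nat) (K - 12))
    by (rewrite <- psum_const; apply psum_le, Hdrop).
  apply le_INR in HM2. rewrite mult_INR in HM2.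
  replace (INR 3) with 3 in HM2 by (simpl; lra).
  replace (INR 12) with 12 in Hup by (simpl; lra).
  rewrite minus_INR in Hlow by lia. replace (INR 12) with 12 in Hlow by (simpl; lra).
  (* The total drop is at most [12 M <= 36 n], and [36 * 18 = 648]. Adding the 12 extreme radii
     gives 660, and [eps < 1] relaxes the power from 2 to 3. *)
  assert (HK : eps ^ 2 * (INR K - 12) <= 648).
  { apply Rmult_le_reg_r with (INR n / 18); [lra|]. lra. }
  apply Rmult_le_reg_r with (eps ^ 3); [lra|].
  unfold Rdiv. rewrite Rmult_assoc, Rinv_l, Rmult_1_r by lra.
  replace (eps ^ 3) with (eps * eps ^ 2) in * by ring. nra.
Qed.

Theorem theorem1p3 :
  exists c : R, 0 < c /\
  forall eps : R, 0 < eps ->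
  exists N : nat, forall n : nat, (N <= n)%nat ->
  forall delta gamma : R, 0 <= delta -> 0 <= gamma ->
    gamma + 2 * delta < 1 - eps ->
  forall (v : list bool) (xs : list (list bool)),
    NoDup xs ->
    (forall x, In x xs ->
       in_code eps n x /\
       exists D I : nat, INR D <= delta * INR n /\ INR I <= gamma * INR n /\
                         del_ins x v D I) ->
    INR (length xs) <= c / eps ^ 3.
Proof.
  exists 660. split; [lra|]. intros eps He0. exists 1%nat.
  intros n Hn delta gamma Hdelta Hgamma Hsum v xs Hnd Hxs.
  (* Nonnegative [delta] and [gamma] force [eps < 1]. *)
  assert (He : 0 < eps < 1) by lra.
  assert (Rn : 0 < INR n) by (apply lt_0_INR; lia).
  assert (Hp : 1 < / eps ^ 4).
  { rewrite <- Rinv_1. apply Rinv_0_lt_contravar; [apply pow_lt; lra|].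
    apply pow_lt_1_compat; [lra|lia]. }
  set (close := fun r =>
     (0 < r < n)%nat /\ (exists k, INR r = (/ eps ^ 4) ^ k) /\
     exists D I, INR I + 2 * INR D < (1 - eps) * INR n /\
                 del_ins (A_prefix r n) v D I).
  (* Closeness is decided classically; filtering [seq] lists the close radii in increasing order. *)
  set (rs := filter (fun r => if excluded_middle_informative (close r) then true else false)
               (seq 0 n)).
  assert (Hrs : forall r, In r rs <-> close r).
  { intros r. unfold rs. rewrite filter_In, in_seq.
    destruct (excluded_middle_informative (close r)) as [Hc|Hc].
    - split; [now intros _|]. intros _. split; [|reflexivity].
      destruct Hc as [Hc _]. lia.
    - split; [intros [_ Hf]; discriminate | intros Hc'; contradiction]. }
  (* The distinct members of [xs] lie in the image of [rs] under [A_prefix], so they are no more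
     numerous than the close radii. *)
  apply Rle_trans with (INR (length rs)).
  - apply le_INR. rewrite <- (length_map (fun r => A_prefix r n) rs).
    apply NoDup_incl_length; [assumption|]. intros x Hx.
    destruct (Hxs x Hx) as [(k & r & Hr & Ek & Hk & ->) (D & I & HD & HI & Hdel)].
    apply in_map_iff. exists r. split; [reflexivity|]. apply Hrs.
    split; [|split; [now exists k|]].
    + split; [assumption|]. now apply (code_radius_lt (/ eps ^ 4) k).
    + exists D, I. split; [|assumption]. nra.
  - apply (close_radii_count eps n v); [assumption | lia | | apply Hrs].
    apply StronglySorted_filter, StronglySorted_seq.
Qed.
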